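(* Let $(\gamma,\nu_1,\nu_2):I\to\mathbb{R}^3_1\times\Delta_2$ be a timelike framed curve with $\mu=\nu_1\times\nu_2$ and curvature $(\alpha,l_1,l_2,l_3)$. Let $\Theta:I\to\mathbb{R}$ be a smooth function and put $$\breve\nu_1=\cos\Theta\,\nu_1-\sin\Theta\,\nu_2,\qquad \breve\nu_2=\sin\Theta\,\nu_1+\cos\Theta\,\nu_2 .$$ Then $(\gamma,\breve\nu_1,\breve\nu_2):I\to\mathbb{R}^3_1\times\Delta_2$ is a timelike framed curve and $\breve\nu_1\times\breve\nu_2=\mu$. Moreover: (1) (Bishop type) If $\Theta'(s)=l_1(s)$ for all $s\in I$, then $$\mu'=\breve l_2\,\breve\nu_1+\breve l_3\,\breve\nu_2,\qquad \breve\nu_1'=\breve l_2\,\mu,\qquad \breve\nu_2'=\breve l_3\,\mu,$$ where $\breve l_2=l_2\cos\Theta-l_3\sin\Theta$ and $\breve l_3=l_2\sin\Theta+l_3\cos\Theta$. (2) (Frenet-Serret type) If $l_2=p\cos\Theta$ and $l_3=-p\sin\Theta$ for a function $p:I\to\mathbb{R}$ with $p(s)=\|\mu'(s)\|\neq0$ for all $s\in I$, then, with $q=-\Theta'+l_1$, $$\mu'=p\,\breve\nu_1,\qquad \breve\nu_1'=p\,\mu+q\,\breve\nu_2,\qquad \breve\nu_2'=-q\,\breve\nu_1 .$$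
   Context: $\mathbb{R}^3_1$ is $\mathbb{R}^3$ with the Lorentzian inner product $\langle\omega,\varsigma\rangle=-\omega_1\varsigma_1+\omega_2\varsigma_2+\omega_3\varsigma_3$, norm $\|\omega\|=\sqrt{|\langle\omega,\omega\rangle|}$, and vector product $\omega\times\varsigma=(-(\omega_2\varsigma_3-\omega_3\varsigma_2),\ \omega_3\varsigma_1-\omega_1\varsigma_3,\ \omega_1\varsigma_2-\omega_2\varsigma_1)$. Put $\mathbb{S}^2_1=\{\omega:\langle\omega,\omega\rangle=1\}$. $I$ is an open interval. $\Delta_2=\{(\nu_1,\nu_2)\in\mathbb{S}^2_1\times\mathbb{S}^2_1:\langle\nu_1,\nu_2\rangle=0,\ \nu_1\times\nu_2 \text{ timelike}\}$ (the last condition is automatic). A timelike framed curve is a smooth map $(\gamma,\nu_1,\nu_2):I\to\mathbb{R}^3_1\times\Delta_2$ with $\langle\gamma',\nu_1\rangle=\langle\gamma',\nu_2\rangle=0$ on $I$. Put $\mu=\nu_1\times\nu_2$, which satisfies $\langle\mu,\mu\rangle=-1$; the smooth function $\alpha$ is defined by $\gamma'=\alpha\mu$ ($\gamma$ may be singular where $\alpha=0$). The smooth functions $l_1=\langle\nu_1',\nu_2\rangle$, $l_2=-\langle\nu_1',\mu\rangle$, $l_3=-\langle\nu_2',\mu\rangle$ satisfy the Frenet-type formulas $$\mu'=l_2\nu_1+l_3\nu_2,\qquad \nu_1'=l_2\mu+l_1\nu_2,\qquad \nu_2'=l_3\mu-l_1\nu_1,$$ and $(\alpha,l_1,l_2,l_3)$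 is called the curvature of the timelike framed curve. *)

(* Defs.v *)
From HB Require Import structures.
From mathcomp Require Import all_boot all_order all_algebra.
From mathcomp Require Import all_classical all_reals all_analysis.
Set Implicit Arguments.
Unset Strict Implicit.
Unset Printing Implicit Defensive.
Import Order.TTheory GRing.Theory Num.Theory.
Import numFieldNormedType.Exports.
Local Open Scope classical_set_scope.
Local Open Scope ring_scope.

(* The indices 0, 1, 2 : 'I_3 are the coordinates usually numbered 1, 2, 3;
   coordinate 0 carries the minus sign. *)
Definition ldot (R : realType) (w v : 'rV[R]_3) : R :=
  - (w 0 0 * v 0 0) + w 0 1 * v 0 1 + w 0 2 * v 0 2.

Definition lnorm (R : realType) (w : 'rV[R]_3) : R := Num.sqrt `|ldot w w|.

Definition lcross (R : realType) (w v : 'rV[R]_3) : 'rV[R]_3 :=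
  \row_(i < 3) [:: - (w 0 1 * v 0 2 - w 0 2 * v 0 1);
                   w 0 2 * v 0 0 - w 0 0 * v 0 2;
                   w 0 0 * v 0 1 - w 0 1 * v 0 0]`_i.

Definition timelike (R : realType) (w : 'rV[R]_3) : Prop := ldot w w < 0.

Definition deSitter (R : realType) : set 'rV[R]_3 :=
  [set w | ldot w w = 1].

Definition Delta2 (R : realType) : set ('rV[R]_3 * 'rV[R]_3) :=
  [set n | [/\ deSitter n.1, deSitter n.2, ldot n.1 n.2 = 0 &
               timelike (lcross n.1 n.2)]].
Arguments Delta2 {R}.

(* Possibly unbounded; the empty set is not excluded. *)
Definition open_interval (R : realType) (I : set R) : Prop :=
  open I /\ is_interval I.

(* Maps on I are represented by total functions on R of which only the values
   on I matter; as I is open, these values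
   determine the iterated derivatives at the points of I. *)
Definition smooth_on (R : realType) (V : normedModType R) (I : set R)
    (f : R -> V) : Prop :=
  forall (n : nat) (s : R), I s -> derivable (derive1n n f) s 1.

Definition timelike_framed_curve (R : realType) (I : set R)
    (gamma nu1 nu2 : R -> 'rV[R]_3) : Prop :=
  [/\ smooth_on I gamma, smooth_on I nu1, smooth_on I nu2,
      forall s, I s -> Delta2 (nu1 s, nu2 s) &
      forall s, I s -> ldot (derive1 gamma s) (nu1 s) = 0 /\
                       ldot (derive1 gamma s) (nu2 s) = 0].

Definition frame_mu (R : realType) (nu1 nu2 : R -> 'rV[R]_3) : R -> 'rV[R]_3 :=
  fun s => lcross (nu1 s) (nu2 s).

(* Smoothness of alpha, l1, l2, l3 on I follows from these equations, since
   <mu, mu> = -1 gives alpha = - <gamma', mu>. *)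
Definition is_curvature (R : realType) (I : set R)
    (gamma nu1 nu2 : R -> 'rV[R]_3) (alpha l1 l2 l3 : R -> R) : Prop :=
  forall s, I s ->
    [/\ derive1 gamma s = alpha s *: frame_mu nu1 nu2 s,
        l1 s = ldot (derive1 nu1 s) (nu2 s),
        l2 s = - ldot (derive1 nu1 s) (frame_mu nu1 nu2 s) &
        l3 s = - ldot (derive1 nu2 s) (frame_mu nu1 nu2 s)].

Definition rot_nu1 (R : realType) (Theta : R -> R) (nu1 nu2 : R -> 'rV[R]_3) :
    R -> 'rV[R]_3 :=
  fun s => cos (Theta s) *: nu1 s - sin (Theta s) *: nu2 s.

Definition rot_nu2 (R : realType) (Theta : R -> R) (nu1 nu2 : R -> 'rV[R]_3) :
    R -> 'rV[R]_3 :=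
  fun s => sin (Theta s) *: nu1 s + cos (Theta s) *: nu2 s.

(* Main.v *)
Require Import Defs.
From HB Require Import structures.
From mathcomp Require Import all_boot all_order all_algebra.
From mathcomp Require Import all_classical all_reals all_analysis.
From mathcomp Require Import ring.
Set Implicit Arguments.
Unset Strict Implicit.
Unset Printing Implicit Defensive.
Import Order.TTheory GRing.Theory Num.Theory.
Import numFieldNormedType.Exports.
Local Open Scope classical_set_scope.
Local Open Scope ring_scope.

(** At each point of I the vectors nu1, nu2, mu form a pseudo-orthonormal basis,
so a vector is determined by its Lorentzian products with them
([Delta2_expansion]).  Differentiating <nu1,nu1> = <nu2,nu2> = 1 and
<nu1,nu2> = 0 makes the missing products vanish or pairs them off, which gives
the Frenet-type formulas for nu1' and nu2' ([frenet_nu]); the one for mu' comes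
from the Leibniz rule for mu = nu1 x nu2 ([frenet_mu]).

A rotation of the spacelike pair (nu1, nu2) by an angle Theta preserves its Gram
matrix and its vector product ([Delta2_rot], [lcross_rot]), and smoothness is
preserved because smooth maps on an open set are closed under sums, under
products with scalar functions and under composition with cos and sin
([smooth_rot]); hence the rotated curve is framed.

For arbitrary Theta the rotated frame satisfies formulas of the same shape, in
which (l2, l3) is rotated by Theta and l1 becomes l1 - Theta'
([frenet_rot]).  The Bishop type frame is the case where l1 - Theta' = 0, and the
Frenet-Serret type frame the case where Theta rotates (l2, l3) to (p, 0). *)

(** * Derivatives of products *)

(** As in the scalar case, the difference quotient of c f at s splits as
c(s + h) (f(s + h) - f(s)) / h + ((c(s + h) - c(s)) / h) f(s). *)
Lemma is_derive_scale (R : realType) (V : normedModType R) (c : R -> R)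
    (f : R -> V) (s dc : R) (df : V) :
  is_derive s 1 c dc -> is_derive s 1 f df ->
  is_derive s 1 (fun t => c t *: f t) (c s *: df + dc *: f s).
Proof.
move=> hc hf.
suff cvg_quot : (fun h => h^-1 *: (((fun t => c t *: f t) \o shift s) (h *: 1)
    - c s *: f s)) @ 0^' --> c s *: df + dc *: f s.
  by apply: DeriveDef; [apply/cvg_ex; eexists; exact: cvg_quot
                       | exact: cvg_lim cvg_quot].
pose quot (W : normedModType R) (g : R -> W) (h : R) :=
  h^-1 *: ((g \o shift s) (h *: 1) - g s).
have quot_cvg (W : normedModType R) (g : R -> W) (dg : W) :
    is_derive s 1 g dg -> quot W g @ 0^' --> dg.
  by move=> [g_s <-].
rewrite (_ : (fun h => _) =
    fun h => c (h *: 1 + s) *: quot V f h + quot R c h *: f s); last first.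
  apply/funext => h; rewrite /quot /= !scalerBr scalerBl !scalerA.
  by rewrite [h^-1 *: _]mulrC [h^-1 *: c s]mulrC addrA subrK [h^-1 * _]mulrC
    [h^-1 * _]mulrC.
have c_cvg : (fun h : R => c (h *: 1 + s)) @ 0^' --> c s.
  suff : {for 0, continuous (fun h : R => c (h *: 1 + s))}.
    by move=> /continuous_withinNx; rewrite scale0r add0r.
  exact/differentiable_continuous/derivable1_diffP/(derivable1P _ _ _).1.
apply: cvgD.
  by apply: cvgZ => //; exact: quot_cvg.
by apply: cvgZ; [exact: quot_cvg|exact: cvg_cst].
Qed.

Lemma is_derive_mxP (R : realType) (m n : nat) (f : R -> 'M[R]_(m, n))
    (s : R) (df : 'M[R]_(m, n)) :
  is_derive s 1 f df <->
  forall i j, is_derive s 1 (fun t => f t i j) (df i j).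
Proof.
split=> [[f_s <-] i j|h].
  by rewrite derive_mx// mxE; apply: derivableP; move/derivable_mxP : f_s.
have f_s : derivable f s 1 by apply/derivable_mxP => i j; case: (h i j).
apply: DeriveDef => //; rewrite derive_mx//; apply/matrixP => i j; rewrite mxE.
by case: (h i j).
Qed.

Lemma is_derive_mul (R : realType) (f g : R -> R) (s df dg : R) :
  is_derive s 1 f df -> is_derive s 1 g dg ->
  is_derive s 1 (fun t => f t * g t) (f s * dg + df * g s).
Proof. exact: is_derive_scale. Qed.

(** * Smooth maps on an open set *)

(** [Cn_on I n f] says that f is n times differentiable on I.  Peeling off the
first derivative instead of iterating lets the closure lemmas below go by
induction on n: the derivative of a compound is a compound of maps that are n
times differentiable. *)
Fixpoint Cn_on (R : realType) (V : normedModType R) (I : set R) (n : nat)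
    (f : R -> V) : Prop :=
  if n is n'.+1 then
    (forall s, I s -> derivable f s 1) /\ Cn_on I n' (derive1 f)
  else True.

Section Smooth.
Variables (R : realType) (I : set R).
Hypothesis openI : open I.

Lemma smooth_onP (V : normedModType R) (f : R -> V) :
  smooth_on I f <-> forall n, Cn_on I n f.
Proof.
split=> [+ n|].
  elim: n f => [//|n IHn] f hf; split; first exact: hf 0%N.
  by apply: IHn => k s Is; rewrite -derive1Sn; exact: hf.
move=> hf n; elim: n f hf => [|n IHn] f hf s Is.
  by have [+ _] := hf 1%N; exact.
by rewrite derive1Sn; apply: IHn => // k; have [] := hf k.+1.
Qed.

Lemma Cn_onW (V : normedModType R) (n : nat) (f : R -> V) :
  Cn_on I n.+1 f -> Cn_on I n f.
Proof.
elim: n f => [//|n IHn] f [f_I hf']; split => //; exact: IHn.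
Qed.

(** Openness matters here: maps that agree on I agree near each point of I, and
so have the same derivatives there, although they may differ outside I. *)
Lemma eq_Cn_on (V : normedModType R) (n : nat) (f g : R -> V) :
  (forall s, I s -> f s = g s) -> Cn_on I n f -> Cn_on I n g.
Proof.
elim: n f g => [//|n IHn] f g fg [f_I hf'].
have near_fg s : I s -> \near s, f s = g s.
  by move=> Is; near=> t; apply: fg; near: t; exact: open_nbhs_nbhs.
split=> [s Is|]; first exact: near_eq_derivable (near_fg s Is) (f_I s Is).
apply: IHn hf' => s Is; rewrite !derive1E; exact/near_eq_derive/near_fg.
Unshelve. all: by end_near. Qed.

(** The working form of the recursion: the derivative only has to be identified
at the points of I. *)
Lemma Cn_on_is_derive (V : normedModType R) (n : nat) (f df : R -> V) :
  (forall s, I s -> is_derive s 1 f (df s)) -> Cn_on I n df ->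
  Cn_on I n.+1 f.
Proof.
move=> hf hdf; split=> [s /hf[]//|].
by apply: eq_Cn_on hdf => s Is; rewrite derive1E; case: (hf s Is).
Qed.

Lemma derivable_derive1 (V : normedModType R) (f : R -> V) (s : R) :
  derivable f s 1 -> is_derive s 1 f (derive1 f s).
Proof. by rewrite derive1E; exact: derivableP. Qed.

Lemma Cn_onD (V : normedModType R) (n : nat) (f g : R -> V) :
  Cn_on I n f -> Cn_on I n g -> Cn_on I n (f + g).
Proof.
elim: n f g => [//|n IHn] f g [f_I hf'] [g_I hg'].
apply: (@Cn_on_is_derive _ _ _ (derive1 f + derive1 g)); last exact: IHn.
by move=> s Is; apply: is_deriveD; apply: derivable_derive1; auto.
Qed.

Lemma Cn_onN (V : normedModType R) (n : nat) (f : R -> V) :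
  Cn_on I n f -> Cn_on I n (- f).
Proof.
elim: n f => [//|n IHn] f [f_I hf'].
apply: (@Cn_on_is_derive _ _ _ (- derive1 f)); last exact: IHn.
by move=> s Is; apply: is_deriveN; apply: derivable_derive1; auto.
Qed.

Lemma Cn_on_scale (V : normedModType R) (n : nat) (c : R -> R) (f : R -> V) :
  Cn_on I n c -> Cn_on I n f -> Cn_on I n (fun s => c s *: f s).
Proof.
elim: n c f => [//|n IHn] c f hc hf.
apply: (@Cn_on_is_derive _ _ _
    ((fun s => c s *: derive1 f s) + (fun s => derive1 c s *: f s))).
  move=> s Is; apply: is_derive_scale; apply: derivable_derive1;
    [exact: hc.1|exact: hf.1].
by apply: Cn_onD; apply: IHn; [exact: Cn_onW|exact: hf.2|exact: hc.2
  |exact: Cn_onW].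
Qed.

(** The two statements are proved together, each being the derivative of the
other up to sign and a factor T'. *)
Lemma Cn_on_cos_sin (n : nat) (T : R -> R) :
  Cn_on I n T -> Cn_on I n (cos \o T) /\ Cn_on I n (sin \o T).
Proof.
elim: n T => [//|n IHn] T hT; have [T_I hT'] := hT.
have [hcos hsin] := IHn T (Cn_onW hT).
have T_der s : I s -> is_derive s 1 T (derive1 T s).
  by move=> Is; exact/derivable_derive1/T_I.
split.
- apply: (@Cn_on_is_derive _ _ _ (fun s => (- (sin \o T)) s *: derive1 T s)).
    by move=> s /T_der T_s; exact: is_derive1_comp.
  by apply: Cn_on_scale hT'; exact: Cn_onN.
- apply: (@Cn_on_is_derive _ _ _ (fun s => (cos \o T) s *: derive1 T s)).
    by move=> s /T_der T_s; exact: is_derive1_comp.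
  exact: Cn_on_scale hT'.
Qed.

Lemma smooth_rot (T : R -> R) (f g : R -> 'rV[R]_3) :
  smooth_on I T -> smooth_on I f -> smooth_on I g ->
  smooth_on I (rot_nu1 T f g) /\ smooth_on I (rot_nu2 T f g).
Proof.
move=> /smooth_onP hT /smooth_onP hf /smooth_onP hg.
split; apply/smooth_onP => n; have [hcos hsin] := Cn_on_cos_sin (hT n).
- by apply: Cn_onD; [|apply: Cn_onN]; exact: Cn_on_scale.
- by apply: Cn_onD; exact: Cn_on_scale.
Qed.

End Smooth.

(** * Algebra of the Lorentzian products *)

Section LorentzAlgebra.
Variable R : realType.
Implicit Types u v w a b c : 'rV[R]_3.

Lemma eq_row3 u v :
  u 0 0 = v 0 0 -> u 0 1 = v 0 1 -> u 0 2 = v 0 2 -> u = v.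
Proof.
move=> h0 h1 h2; apply/rowP => -[[|[|[|//]]] hi].
- by rewrite (_ : Ordinal hi = 0)//; exact: val_inj.
- by rewrite (_ : Ordinal hi = 1)//; exact: val_inj.
- by rewrite (_ : Ordinal hi = 2)//; exact: val_inj.
Qed.

Lemma lcross_coord u v :
  ((lcross u v 0 0 = - (u 0 1 * v 0 2 - u 0 2 * v 0 1)) *
   (lcross u v 0 1 = u 0 2 * v 0 0 - u 0 0 * v 0 2) *
   (lcross u v 0 2 = u 0 0 * v 0 1 - u 0 1 * v 0 0))%type.
Proof. by rewrite /lcross !mxE. Qed.

(** Lorentzian form of the triple product expansion; the sign is opposite to the
Euclidean one. *)
Lemma lcross_lcross a b c :
  lcross a (lcross b c) = ldot a b *: c - ldot a c *: b.
Proof.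
by apply: eq_row3; rewrite !(lcross_coord, mxE) /ldot /=; ring.
Qed.

Lemma lcrossC a b : lcross b a = - lcross a b.
Proof. by apply: eq_row3; rewrite !(lcross_coord, mxE); ring. Qed.

Lemma lcross_self a : lcross a a = 0.
Proof. by apply: eq_row3; rewrite !(lcross_coord, mxE); ring. Qed.

Lemma lcross_combl (x y : R) a b c :
  lcross (x *: a + y *: b) c = x *: lcross a c + y *: lcross b c.
Proof. by apply: eq_row3; rewrite !(lcross_coord, mxE); ring. Qed.

Lemma lcross_combr (x y : R) a b c :
  lcross c (x *: a + y *: b) = x *: lcross c a + y *: lcross c b.
Proof. by apply: eq_row3; rewrite !(lcross_coord, mxE); ring. Qed.

Lemma ldotC a b : ldot a b = ldot b a.
Proof. by rewrite /ldot; ring. Qed.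

Lemma ldot_combr (x y : R) a b c :
  ldot c (x *: a + y *: b) = x * ldot c a + y * ldot c b.
Proof. by rewrite /ldot !mxE; ring. Qed.

(** Lagrange's identity, again with the sign opposite to the Euclidean one: the
product of an orthonormal spacelike pair has square -1. *)
Lemma ldot_lcross a b :
  ldot (lcross a b) (lcross a b) = ldot a b ^+ 2 - ldot a a * ldot b b.
Proof. by rewrite /ldot !lcross_coord; ring. Qed.

(** Cramer's rule: <a x b, c> is the determinant of (a, b, c), and the vector
products form the dual basis up to that determinant. *)
Lemma lorentz_cramer a b c w :
  ldot (lcross a b) c *: w =
    ldot w a *: lcross b c + ldot w b *: lcross c a + ldot w c *: lcross a b.
Proof. by apply: eq_row3; rewrite /ldot !(lcross_coord, mxE); ring. Qed.

(** Cramer's rule for c = a x b, whose determinant <c, c> is -1 and whose dual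
basis vectors are -a, -b and c. *)
Lemma Delta2_expansion a b w : Delta2 (a, b) ->
  w = ldot w a *: a + ldot w b *: b - ldot w (lcross a b) *: lcross a b.
Proof.
case; rewrite /deSitter /= => aa bb ab _.
have := lorentz_cramer a b (lcross a b) w.
rewrite ldot_lcross (lcrossC a (lcross a b)) !lcross_lcross.
rewrite (ldotC b a) aa bb ab expr0n mulr1 !sub0r !scale1r !scale0r subr0 add0r.
by rewrite scaleN1r => h; rewrite -[LHS]opprK h !scalerN !opprD !opprK.
Qed.

Lemma Delta2_cross_mu a b : Delta2 (a, b) ->
  lcross a (lcross a b) = b /\ lcross (lcross a b) b = a.
Proof.
case; rewrite /deSitter /= => aa bb ab _.
rewrite (lcrossC b (lcross a b)) !lcross_lcross (ldotC b a) aa bb ab.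
by rewrite !scale1r !scale0r subr0 sub0r opprK.
Qed.

Lemma lcross_rot (c s : R) a b : c ^+ 2 + s ^+ 2 = 1 ->
  lcross (c *: a - s *: b) (s *: a + c *: b) = lcross a b.
Proof.
move=> cs1; rewrite -[RHS]scale1r -cs1.
by apply: eq_row3; rewrite !(lcross_coord, mxE); ring.
Qed.

Lemma Delta2_rot (c s : R) a b : c ^+ 2 + s ^+ 2 = 1 ->
  Delta2 (a, b) -> Delta2 (c *: a - s *: b, s *: a + c *: b).
Proof.
move=> cs1 [/= aa bb ab tl]; rewrite /deSitter /= in aa bb.
have gram (x y z t : R) :
    ldot (x *: a + y *: b) (z *: a + t *: b) = x * z + y * t.
  rewrite ldot_combr (ldotC _ a) (ldotC _ b) !ldot_combr (ldotC b a) aa bb ab.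
  by ring.
split; rewrite /deSitter /= -?scaleNr ?gram.
- by rewrite -cs1; ring.
- by rewrite -cs1; ring.
- by ring.
- by rewrite scaleNr lcross_rot.
Qed.

End LorentzAlgebra.

(** * Frenet-type formulas *)

Section Frenet.
Variable R : realType.

Lemma is_derive_ldot (f g : R -> 'rV[R]_3) (s : R) (df dg : 'rV[R]_3) :
  is_derive s 1 f df -> is_derive s 1 g dg ->
  is_derive s 1 (fun t => ldot (f t) (g t)) (ldot df (g s) + ldot (f s) dg).
Proof.
move=> /is_derive_mxP hf /is_derive_mxP hg.
pose P i := is_derive_mul (hf 0 i) (hg 0 i).
apply: is_derive_eq (is_deriveD (is_deriveD (is_deriveN (P 0)) (P 1)) (P 2)) _.
by rewrite /ldot; ring.
Qed.

Lemma is_derive_lcross (f g : R -> 'rV[R]_3) (s : R) (df dg : 'rV[R]_3) :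
  is_derive s 1 f df -> is_derive s 1 g dg ->
  is_derive s 1 (fun t => lcross (f t) (g t))
    (lcross df (g s) + lcross (f s) dg).
Proof.
move=> /is_derive_mxP hf /is_derive_mxP hg.
have P i j := is_derive_mul (hf 0 i) (hg 0 j).
have Q i j k l := is_deriveB (P i j) (P k l).
apply/is_derive_mxP => i j; rewrite (ord1 i) {i}.
case: j => -[|[|[|//]]] hj.
- rewrite (_ : Ordinal hj = 0); last exact: val_inj.
  under eq_fun do rewrite lcross_coord.
  apply: is_derive_eq (is_deriveN (Q 1 2 2 1)) _.
  by rewrite !(lcross_coord, mxE); ring.
- rewrite (_ : Ordinal hj = 1); last exact: val_inj.
  under eq_fun do rewrite lcross_coord.
  apply: is_derive_eq (Q 2 0 0 2) _.
  by rewrite !(lcross_coord, mxE); ring.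
- rewrite (_ : Ordinal hj = 2); last exact: val_inj.
  under eq_fun do rewrite lcross_coord.
  apply: is_derive_eq (Q 0 1 1 0) _.
  by rewrite !(lcross_coord, mxE); ring.
Qed.

(** Used on the constant functions <nu_i, nu_j>. *)
Lemma is_derive_cst_on (I : set R) (f : R -> R) (k s df : R) : open I -> I s ->
  (forall t, I t -> f t = k) -> is_derive s 1 f df -> df = 0.
Proof.
move=> openI Is fk [_ <-]; rewrite -(derive_cst k s 1).
apply: near_eq_derive; near=> t; apply: fk; near: t; exact: open_nbhs_nbhs.
Unshelve. all: by end_near. Qed.

Lemma smooth_on_is_derive (V : normedModType R) (I : set R) (f : R -> V)
    (s : R) : smooth_on I f -> I s -> is_derive s 1 f (derive1 f s).
Proof. by move=> hf Is; exact/derivable_derive1/(hf 0%N). Qed.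

Lemma derive1_val (V : normedModType R) (f : R -> V) (s : R) (df : V) :
  is_derive s 1 f df -> derive1 f s = df.
Proof. by rewrite derive1E => -[]. Qed.

Variables (I : set R) (gamma nu1 nu2 : R -> 'rV[R]_3).
Variables (alpha l1 l2 l3 : R -> R).
Hypothesis openI : open I.
Hypothesis hcurve : timelike_framed_curve I gamma nu1 nu2.
Hypothesis hcurv : is_curvature I gamma nu1 nu2 alpha l1 l2 l3.
Let mu := frame_mu nu1 nu2.

(** Both derivatives are expanded in the frame: <nu_i', nu_i> = 0, and
<nu2', nu1> = - <nu1', nu2> = - l1. *)
Lemma frenet_nu (s : R) : I s ->
  derive1 nu1 s = l2 s *: mu s + l1 s *: nu2 s /\
  derive1 nu2 s = l3 s *: mu s - l1 s *: nu1 s.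
Proof.
move=> Is; have [_ smooth1 smooth2 hD _] := hcurve.
have [_ l1E l2E l3E] := hcurv Is.
have d1 := smooth_on_is_derive smooth1 Is.
have d2 := smooth_on_is_derive smooth2 Is.
have d11 : ldot (derive1 nu1 s) (nu1 s) + ldot (nu1 s) (derive1 nu1 s) = 0.
  apply: (is_derive_cst_on (k := 1) openI Is _ (is_derive_ldot d1 d1)).
  by move=> t /hD[].
have d22 : ldot (derive1 nu2 s) (nu2 s) + ldot (nu2 s) (derive1 nu2 s) = 0.
  apply: (is_derive_cst_on (k := 1) openI Is _ (is_derive_ldot d2 d2)).
  by move=> t /hD[].
have d12 : ldot (derive1 nu1 s) (nu2 s) + ldot (nu1 s) (derive1 nu2 s) = 0.
  apply: (is_derive_cst_on (k := 0) openI Is _ (is_derive_ldot d1 d2)).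
  by move=> t /hD[].
have d11_0 : ldot (derive1 nu1 s) (nu1 s) = 0.
  by move/eqP: d11; rewrite ldotC -mulr2n mulrn_eq0 /= => /eqP.
have d22_0 : ldot (derive1 nu2 s) (nu2 s) = 0.
  by move/eqP: d22; rewrite ldotC -mulr2n mulrn_eq0 /= => /eqP.
have d21 : ldot (derive1 nu2 s) (nu1 s) = - l1 s.
  by rewrite l1E ldotC; apply/eqP; rewrite -addr_eq0 addrC d12.
split.
- rewrite [LHS](Delta2_expansion _ (hD s Is)) d11_0 -l1E scale0r add0r.
  by rewrite addrC -scaleNr -l2E.
- rewrite [LHS](Delta2_expansion _ (hD s Is)) d22_0 d21 scale0r addr0.
  by rewrite addrC -scaleNr -l3E scaleNr.
Qed.

(** By the Leibniz rule and the formulas for nu1' and nu2',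
mu' = l2 mu x nu2 + l3 nu1 x mu, where mu x nu2 = nu1 and nu1 x mu = nu2. *)
Lemma frenet_mu (s : R) : I s ->
  derive1 mu s = l2 s *: nu1 s + l3 s *: nu2 s.
Proof.
move=> Is; have [_ smooth1 smooth2 hD _] := hcurve.
have d1 := smooth_on_is_derive smooth1 Is.
have d2 := smooth_on_is_derive smooth2 Is.
have [e1 e2] := frenet_nu Is.
have [c1 c2] := Delta2_cross_mu (hD s Is).
rewrite (derive1_val (is_derive_lcross d1 d2)) e1 e2.
rewrite -(scaleNr (l1 s)) lcross_combl lcross_combr !lcross_self !scaler0.
by rewrite !addr0 c1 c2.
Qed.

Variable Theta : R -> R.
Hypothesis hTheta : smooth_on I Theta.
Let bnu1 := rot_nu1 Theta nu1 nu2.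
Let bnu2 := rot_nu2 Theta nu1 nu2.

Lemma rot_mu (s : R) : lcross (bnu1 s) (bnu2 s) = mu s.
Proof. by rewrite lcross_rot// cos2Dsin2. Qed.

Lemma rot_framed_curve : timelike_framed_curve I gamma bnu1 bnu2.
Proof.
have [smooth0 smooth1 smooth2 hD tangent] := hcurve.
have [bsmooth1 bsmooth2] := smooth_rot openI hTheta smooth1 smooth2.
split=> [|||s Is|s Is].
- exact: smooth0.
- exact: bsmooth1.
- exact: bsmooth2.
- exact: (Delta2_rot (cos2Dsin2 _) (hD s Is)).
have [t1 t2] := tangent s Is.
rewrite /bnu1 /bnu2 /rot_nu1 /rot_nu2 -scaleNr !ldot_combr t1 t2.
by rewrite !mulr0 addr0.
Qed.

(** The rotated frame obeys the Frenet-type formulas with curvature functions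
(l1 - Theta', bl2, bl3), where (bl2, bl3) is (l2, l3) rotated by Theta; this
holds for every smooth Theta and contains both special frames. *)
Lemma frenet_rot (s : R) : I s ->
  let bl1 := l1 s - derive1 Theta s in
  let bl2 := l2 s * cos (Theta s) - l3 s * sin (Theta s) in
  let bl3 := l2 s * sin (Theta s) + l3 s * cos (Theta s) in
  [/\ derive1 mu s = bl2 *: bnu1 s + bl3 *: bnu2 s,
      derive1 bnu1 s = bl2 *: mu s + bl1 *: bnu2 s &
      derive1 bnu2 s = bl3 *: mu s - bl1 *: bnu1 s].
Proof.
move=> Is bl1 bl2 bl3; have [_ smooth1 smooth2 _ _] := hcurve.
have d1 := smooth_on_is_derive smooth1 Is.
have d2 := smooth_on_is_derive smooth2 Is.
have dT := smooth_on_is_derive hTheta Is.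
have dcos : is_derive s 1 (cos \o Theta) (- sin (Theta s) * derive1 Theta s).
  exact: is_derive1_comp.
have dsin : is_derive s 1 (sin \o Theta) (cos (Theta s) * derive1 Theta s).
  exact: is_derive1_comp.
have [e1 e2] := frenet_nu Is.
split.
- rewrite frenet_mu// /bnu1 /bnu2 /rot_nu1 /rot_nu2 /bl2 /bl3.
  (* Expanding the right-hand side yields cos^2 + sin^2 as a common factor. *)
  rewrite -[LHS]scale1r -(cos2Dsin2 (Theta s)).
  by apply/rowP => i; rewrite !mxE; ring.
- rewrite (derive1_val (is_deriveB
    (is_derive_scale dcos d1)
    (is_derive_scale dsin d2))) e1 e2.
  by apply/rowP => i; rewrite !mxE /= /bl1 /bl2; ring.
- rewrite (derive1_val (is_deriveD
    (is_derive_scale dsin d1)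
    (is_derive_scale dcos d2))) e1 e2.
  by apply/rowP => i; rewrite !mxE /= /bl1 /bl3; ring.
Qed.

End Frenet.

Theorem mainTheorem2 (R : realType) (I : set R)
    (gamma nu1 nu2 : R -> 'rV[R]_3) (alpha l1 l2 l3 Theta : R -> R)
    (hI : open_interval I)
    (hcurve : timelike_framed_curve I gamma nu1 nu2)
    (hcurv : is_curvature I gamma nu1 nu2 alpha l1 l2 l3)
    (hTheta : smooth_on I Theta) :
  let mu := frame_mu nu1 nu2 in
  let bnu1 := rot_nu1 Theta nu1 nu2 in
  let bnu2 := rot_nu2 Theta nu1 nu2 in
  [/\ timelike_framed_curve I gamma bnu1 bnu2,
      forall s, I s -> lcross (bnu1 s) (bnu2 s) = mu s,
      (forall s, I s -> derive1 Theta s = l1 s) ->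
        let bl2 := fun s => l2 s * cos (Theta s) - l3 s * sin (Theta s) in
        let bl3 := fun s => l2 s * sin (Theta s) + l3 s * cos (Theta s) in
        forall s, I s ->
          [/\ derive1 mu s = bl2 s *: bnu1 s + bl3 s *: bnu2 s,
              derive1 bnu1 s = bl2 s *: mu s &
              derive1 bnu2 s = bl3 s *: mu s]
    & forall p : R -> R,
        (forall s, I s ->
          [/\ l2 s = p s * cos (Theta s),
              l3 s = - p s * sin (Theta s),
              p s = lnorm (derive1 mu s) &
              p s <> 0]) ->
        let q := fun s => - derive1 Theta s + l1 s in
        forall s, I s ->
          [/\ derive1 mu s = p s *: bnu1 s,
              derive1 bnu1 s = p s *: mu s + q s *: bnu2 s &
              derive1 bnu2 s = - q s *: bnu1 s]].
Proof.
move=> mu bnu1 bnu2; have openI := hI.1.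
have rotE := frenet_rot openI hcurve hcurv hTheta.
split.
- exact: rot_framed_curve.
- by move=> s _; exact: rot_mu.
(* Bishop type: the l1-entry of the rotated frame vanishes. *)
- move=> dTheta bl2 bl3 s Is; have [-> -> ->] := rotE s Is.
  by rewrite dTheta// subrr !scale0r addr0 subr0.
(* Frenet-Serret type: the rotated pair (bl2, bl3) is (p, 0). *)
- move=> p hp q s Is; have [-> -> ->] := rotE s Is.
  have [-> -> _ _] := hp s Is.
  have -> : p s * cos (Theta s) * cos (Theta s) -
      - p s * sin (Theta s) * sin (Theta s) = p s.
    by rewrite -[RHS]mulr1 -(cos2Dsin2 (Theta s)); ring.
  have -> : p s * cos (Theta s) * sin (Theta s) +
      - p s * sin (Theta s) * cos (Theta s) = 0 by ring.
  have -> : l1 s - derive1 Theta s = q s by rewrite addrC.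
  by rewrite !scale0r addr0 sub0r scaleNr.
Qed.
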